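(* As $n\to\infty$, $$R(n)\;=\;\Bigl(\tfrac34+o(1)\Bigr)\,n\cdot2^{M_n^{*}},\qquad M_n^{*}=3^{\,n-1}-2^{\,n-1}+2.$$
   Context: $[n]=\{1,\dots,n\}$; $V_n$ is the set of nonempty subsets of $[n]$. A family $\mathcal F\subseteq V_n$ is intersecting if $A\cap B\ne\varnothing$ for all $A,B\in\mathcal F$. Its kernel is $\ker\mathcal F=\bigcap_{S\in\mathcal F}S$, with $\ker\varnothing=[n]$. The weight is $w(S)=2^{2^{n-|S|}}-1$ for $S\in V_n$, and $R(n)=\sum_{\mathcal F}\prod_{S\in\mathcal F}w(S)$, the sum over all intersecting families $\mathcal F\subseteq V_n$ with $\ker\mathcal F=\varnothing$. *)

(* Defs.v *)
From mathcomp Require Import all_boot.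

Set Implicit Arguments.
Unset Strict Implicit.
Unset Printing Implicit Defensive.

(* The ground set [n] = {1, ..., n} is represented by 'I_n. *)

Definition V (n : nat) : {set {set 'I_n}} := [set S | S != set0].

Definition intersecting (n : nat) (F : {set {set 'I_n}}) : bool :=
  [forall A in F, forall B in F, A :&: B != set0].

(* The empty intersection is [set: 'I_n], so ker set0 is the whole ground set. *)
Definition ker (n : nat) (F : {set {set 'I_n}}) : {set 'I_n} :=
  \bigcap_(S in F) S.

Definition weight (n : nat) (S : {set 'I_n}) : nat := 2 ^ (2 ^ (n - #|S|)) - 1.

Definition Rsum (n : nat) : nat :=
  \sum_(F : {set {set 'I_n}} | [&& F \subset V n, intersecting F & ker F == set0])
    \prod_(S in F) weight S.

(* The truncated subtractions are exact for 0 < n; at n = 0 the value is junk. *)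
Definition Mstar (n : nat) : nat := 3 ^ (n - 1) - 2 ^ (n - 1) + 2.

(* Main.v *)
Require Import Defs.
From mathcomp Require Import all_boot zify ring.

Set Implicit Arguments.
Unset Strict Implicit.
Unset Printing Implicit Defensive.

(** Give [F] the mass [\sum_(S in F) 2 ^ (n - #|S|)]; the subfamilies of [F] have
    total weight [2 ^ mass F].  Colour the ground set with three colours: colour
    classes are disjoint, so at most one of them lies in an intersecting family
    [G], whence [3 * mass G] plus the number of colourings avoiding [G] equals
    [3 ^ n].  Extend [F] to a maximal intersecting [G], which contains exactly one
    set of each complementary pair.
    If [G] has no set of size at most 2, at least [2 ^ (n - 1)] pivotal pairs
    [(a, S)] (with [S \notin G] and [a |: S \in G]), combined with a further element
    [b], give at least [3 * 2 ^ n] avoiding colourings, and the at most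
    [2 ^ 2 ^ (n - 1)] such [G] are negligible.
    If [[set a; b] \in G], the avoiding colourings are the pairs [X \subset W] of
    subsets of the remaining elements with [a |: X \notin G] and [a |: W \in G], up
    to the 6 permutations of the colours.  Either [G] is the Hilton-Milner family
    of [a] or [b], or there are about [3 / 2 * 2 ^ (n - 2)] such pairs, against at
    most [3 ^ 2 ^ (n - 3)] families [G].
    Only subfamilies of the [n] Hilton-Milner families remain; these must contain
    [~: [set a]], of weight 3 out of 4, which is where [3 / 4] comes from. *)

(** * Sums over families *)

(** Expand [\prod_x (f x + g x)] over all subsets: [f] vanishes off [U] and [g] vanishes on [C], so
    exactly the sets between [C] and [U] survive. *)
Lemma sum_prod_between (T : finType) (w : T -> nat) (C U : {set T}) :
  C \subset U ->
  \sum_(F : {set T} | (C \subset F) && (F \subset U)) \prod_(x in F) w x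
  = (\prod_(x in C) w x) * \prod_(x in U :\: C) (w x).+1.
Proof.
move=> sCU.
pose f x := if x \in U then w x else 0.
pose g x := if x \in C then 0 else 1.
have := @bigA_distr nat 0 1 muln addn _ f g.
have -> : \prod_x (f x + g x)
        = (\prod_(x in C) w x) * \prod_(x in U :\: C) (w x).+1.
  rewrite (bigID (mem C)) /=; congr (_ * _).
    by apply: eq_bigr => x xC; rewrite /f /g (subsetP sCU _ xC) xC addn0.
  rewrite (bigID (mem U)) /= [X in _ * X]big1 ?muln1.
    apply: eq_big => [x|x /andP[xC xU]]; first by rewrite inE.
    by rewrite /f /g xU (negPf xC) addn1.
  by move=> x /andP[xC xU]; rewrite /f /g (negPf xU) (negPf xC).
move=> ->; rewrite big_mkcond /=; apply: eq_bigr => F _.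
case: ifP => [/andP[sCF sFU]|/negbT].
  rewrite [LHS]big_mkcond /=; apply: eq_bigr => x _; rewrite /f /g.
  case: ifP => [xF|/negbT xF]; first by rewrite (subsetP sFU _ xF).
  by case: ifP => // xC; rewrite (subsetP sCF _ xC) in xF.
rewrite negb_and => /orP[] /subsetPn[x x1 x2]; rewrite (bigD1 x) //= /f /g.
  by rewrite (negPf x2) x1.
by rewrite x1 (negPf x2).
Qed.

Lemma sum_prod_subsets (T : finType) (w : T -> nat) (U : {set T}) :
  \sum_(F : {set T} | F \subset U) \prod_(x in F) w x
  = \prod_(x in U) (w x).+1.
Proof.
have := sum_prod_between w (sub0set U); rewrite big_set0 mul1n setD0 => <-.
by apply: eq_bigl => F; rewrite sub0set.
Qed.

Lemma sum_pred_cover (I J : finType) (P : pred I) (Q : J -> pred I)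
    (f : I -> nat) :
  (forall i, P i -> [exists j, Q j i]) ->
  \sum_(i | P i) f i <= \sum_j \sum_(i | Q j i) f i.
Proof.
move=> PQ; rewrite (exchange_big_dep predT) //= big_mkcond; apply: leq_sum => i _.
case: ifP => // /PQ /existsP[j Qj].
by rewrite (bigD1 j) //= leq_addr.
Qed.

Lemma sum_predU_leq (I : finType) (P Q S : pred I) (f : I -> nat) :
  (forall i, P i -> Q i || S i) ->
  \sum_(i | P i) f i <= \sum_(i | Q i) f i + \sum_(i | S i) f i.
Proof.
move=> PQ; rewrite !(big_mkcond P) (big_mkcond Q) (big_mkcond S) -big_split /=.
apply: leq_sum => i _; case: ifP => // /PQ /orP[] ->.
  exact: leq_addr.
exact: leq_addl.
Qed.

Lemma sum_pred_packing (I J : finType) (P : pred I) (Q : J -> pred I)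
    (f : I -> nat) :
  (forall j i, Q j i -> P i) ->
  (forall j k i, Q j i -> Q k i -> j = k) ->
  \sum_j \sum_(i | Q j i) f i <= \sum_(i | P i) f i.
Proof.
move=> QP Qinj; rewrite (exchange_big_dep P) /=; last by move=> j i _; exact: QP.
apply: leq_sum => i Pi.
case: (pickP (Q^~ i)) => [j Qj|Q0]; last by rewrite big_pred0.
rewrite (bigD1 j) //= big1 ?addn0 // => k /andP[Qk /eqP kj].
by case: kj; apply: Qinj Qk Qj.
Qed.

(** Each element of [E] lies in X, in W minus X, or outside W. These three states are the values 2,
    1, 0 of a map supported on [E], and [d] decodes such a map. *)
Lemma card_subset_pairs (T : finType) (E : {set T}) :
  #|[set p : {set T} * {set T} | (p.1 \subset p.2) && (p.2 \subset E)]|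
  <= 3 ^ #|E|.
Proof.
rewrite -[3]card_ord -(card_pffun_on ord0).
pose d (f : {ffun T -> 'I_3}) :=
  ([set x | f x == inord 2], [set x | f x != ord0]).
have i20 : (inord 2 : 'I_3) != ord0 by rewrite -val_eqE /= inordK.
have i10 : (inord 1 : 'I_3) != ord0 by rewrite -val_eqE /= inordK.
have i12 : (inord 1 : 'I_3) != inord 2 by rewrite -val_eqE /= !inordK.
apply: leq_trans (leq_imset_card d _); apply: subset_leq_card.
apply/subsetP => -[X W]; rewrite inE /= => /andP[sXW sWE].
pose f := [ffun x => if x \in X then inord 2 else
                     if x \in W then inord 1 else (ord0 : 'I_3)].
apply/imsetP; exists f.
  apply/pffun_onP; split; last by move=> y _.
  apply/supportP => x xE; rewrite ffunE.
  have xW : x \notin W by apply: contra xE; exact: subsetP.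
  have xX : x \notin X by apply: contra xW; exact: subsetP.
  by rewrite (negPf xW) (negPf xX).
rewrite /d; congr (_, _); apply/setP => x; rewrite inE ffunE.
  case: ifP => [_|_]; first by rewrite eqxx.
  by case: ifP => _; [rewrite (negPf i12) | rewrite eq_sym (negPf i20)].
case: ifP => [xX|_]; first by rewrite i20 (subsetP sXW).
by case: ifP => [_|_]; rewrite ?i10 ?eqxx.
Qed.

(** * The mass of a family *)

Lemma card_setC n (S : {set 'I_n}) : #|~: S| = n - #|S|.
Proof. by have := cardsC S; rewrite card_ord; lia. Qed.

Definition mass n (U : {set {set 'I_n}}) : nat := \sum_(S in U) 2 ^ (n - #|S|).

Lemma prod_weightS n (U : {set {set 'I_n}}) :
  \prod_(S in U) (weight S).+1 = 2 ^ mass U.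
Proof.
rewrite expn_sum; apply: eq_bigr => S _.
by rewrite /weight subn1 prednK // expn_gt0.
Qed.

(** [2 ^ (n - #|S|)] is a product over the ground set with factor 1 in [S] and 2 outside; putting 0
    for the 2 at [a] removes the sets that miss [a]. *)
Lemma mass_star n (a : 'I_n) : mass [set S : {set 'I_n} | a \in S] = 3 ^ (n - 1).
Proof.
pose g x := if x == a then 0 else 2.
have := @bigA_distr nat 0 1 muln addn _ (fun=> 1) g.
have -> : \prod_x (1 + g x) = 3 ^ (n - 1).
  rewrite (bigD1 a) //= {1}/g eqxx mul1n.
  rewrite (eq_bigr (fun=> 3)) => [|x /negPf xa]; last by rewrite /g xa.
  by rewrite prod_nat_const cardC1 card_ord subn1.
move=> ->; rewrite /mass big_mkcond /=; apply: eq_bigr => S _; rewrite inE.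
rewrite (bigID (mem S)) /= [X in X * _]big1 ?mul1n; last by move=> i ->.
rewrite (eq_bigr g) => [|i /negPf -> //].
case: ifP => [aS|/negbT aS]; last by rewrite (bigD1 a) //= /g eqxx.
rewrite (eq_bigr (fun=> 2)); last first.
  by move=> i iS; rewrite /g; case: eqP => // ia; rewrite ia aS in iS.
rewrite prod_nat_const -card_setC; congr (2 ^ _).
by apply: eq_card => x; rewrite inE.
Qed.

(** * Maximal intersecting families *)

(** Maximality is expressed through complementary pairs, the form in which it is used. For [n = 0]
    no such family exists, as the empty set is its own complement. *)
Definition maximal_intersecting n (F : {set {set 'I_n}}) : bool :=
  intersecting F && [forall A, (A \in F) || (~: A \in F)].

Lemma intersectingP n (F : {set {set 'I_n}}) :
  reflect {in F &, forall A B, A :&: B != set0} (intersecting F).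
Proof.
apply: (iffP forall_inP) => [h A B AF BF|h A AF].
  by have /forall_inP := h _ AF; apply.
by apply/forall_inP => B; apply: h.
Qed.

Lemma maximal_intersectingC n (F : {set {set 'I_n}}) (A : {set 'I_n}) :
  maximal_intersecting F -> (~: A \in F) = (A \notin F).
Proof.
case/andP => /intersectingP iF /forallP /(_ A).
case: (boolP (A \in F)) => //= AF _; apply/negP => AcF.
by have := iF _ _ AF AcF; rewrite setICr eqxx.
Qed.

Lemma maximal_intersectingS n (F : {set {set 'I_n}}) (A B : {set 'I_n}) :
  maximal_intersecting F -> A \in F -> A \subset B -> B \in F.
Proof.
move=> mF AF sAB; apply: contraT; rewrite -(maximal_intersectingC _ mF) => BcF.
case/andP: mF => /intersectingP iF _; have := iF _ _ AF BcF.
by rewrite -setDE (eqP (_ : A :\: B == set0)) ?eqxx // setD_eq0.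
Qed.

(** Take [G] maximal under inclusion. A nonempty [A] outside [G] misses some member [B], for
    otherwise it could be added; then [~: A] contains [B], so it meets every member and already
    belongs to [G]. *)
Lemma maximal_intersecting_extension n (F : {set {set 'I_n}}) :
  0 < n -> intersecting F ->
  exists2 G, maximal_intersecting G & F \subset G.
Proof.
move=> n0 iF; have [G /maxsetP[iG maxG] sFG] := maxset_exists iF.
exists G => //; rewrite /maximal_intersecting iG /=; apply/forallP => A.
have {}iG := intersectingP _ iG.
case: (boolP (A \in G)) => //= AG.
have T0 : [set: 'I_n] != set0.
  by apply/set0Pn; exists (Ordinal n0).
have add B : B != set0 -> (forall C, C \in G -> B :&: C != set0) -> B \in G.
  move=> B0 hB; rewrite -(maxG (B |: G)) ?setU11 ?subsetUr //.
  apply/intersectingP => C D; rewrite !inE => /orP[/eqP->|CG] /orP[/eqP->|DG].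
  - by rewrite setIid.
  - exact: hB.
  - by rewrite setIC hB.
  - exact: iG.
case: (eqVneq A set0) => [->|A0].
  rewrite setC0; apply: add => // C CG.
  by rewrite setTI; have := iG _ _ CG CG; rewrite setIid.
case: (boolP [exists B in G, A :&: B == set0]) => [/exists_inP[B BG /eqP AB]|].
  have sB : B \subset ~: A by rewrite -disjoints_subset -setI_eq0 setIC AB.
  have B0 : B != set0 by have := iG _ _ BG BG; rewrite setIid.
  apply: add => [|C CG].
    by apply: contraNneq B0 => Ac0; rewrite Ac0 subset0 in sB.
  have := iG _ _ BG CG; apply: contraNneq => AcC.
  by rewrite -subset0 -AcC setSI.
rewrite negb_exists_in => /forall_inP h; case/negP: AG.
by apply: add => // C /h.
Qed.

Lemma card_sets_containing n (a : 'I_n) :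
  #|[set S : {set 'I_n} | a \in S]| <= 2 ^ (n - 1).
Proof.
have -> : n - 1 = #|~: [set a]| by rewrite card_setC cards1.
rewrite -card_powerset -[X in X <= _](card_in_imset (f := fun S => S :\ a)).
  apply: subset_leq_card; apply/subsetP => X /imsetP[S _ ->].
  by rewrite inE setDE subsetIr.
move=> S S' /=; rewrite !inE => aS aS' eqS.
by rewrite -(setD1K aS) -(setD1K aS') eqS.
Qed.

(** The members through a fixed point [a] determine the family: a set missing [a] is a member
    exactly when its complement is not. *)
Lemma card_maximal_intersecting n : 0 < n ->
  #|[set F : {set {set 'I_n}} | maximal_intersecting F]| <= 2 ^ (2 ^ (n - 1)).
Proof.
move=> n0; pose a := Ordinal n0; pose U := [set S : {set 'I_n} | a \in S].
rewrite -[X in X <= _](card_in_imset (f := fun F => F :&: U)).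
  apply: leq_trans (_ : #|powerset U| <= _).
    apply: subset_leq_card; apply/subsetP => X /imsetP[S _ ->].
    by rewrite inE subsetIr.
  by rewrite card_powerset leq_exp2l // card_sets_containing.
move=> F G /=; rewrite !inE => mF mG eqFG.
have aFG (S : {set 'I_n}) : a \in S -> (S \in F) = (S \in G).
  by move=> aS; have /setP/(_ S) := eqFG; rewrite !inE aS !andbT.
apply/setP => S; case: (boolP (a \in S)) => [|aS]; first exact: aFG.
apply: negb_inj; rewrite -!maximal_intersectingC //.
by apply: aFG; rewrite inE.
Qed.

(* Modulo complementation such a family is determined by an up-set in the cube
   on the complement of [set a; b]; splitting that cube along [c] leaves three
   possible states for each parallel edge. *)
Lemma card_maximal_intersecting_pair n (a b : 'I_n) : a != b -> 2 < n ->
  #|[set F : {set {set 'I_n}} | maximal_intersecting F & [set a; b] \in F]|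
  <= 3 ^ (2 ^ (n - 3)).
Proof.
move=> ab n2.
have [c] : exists c, c \in ~: [set a; b].
  by apply/set0Pn; rewrite -card_gt0 card_setC cards2 ab; lia.
rewrite !inE negb_or => /andP[ca cb].
pose E := ~: [set a; b; c].
have cE : #|E| = n - 3.
  by rewrite /E card_setC setUC cardsU1 cards2 !inE negb_or ca cb ab.
pose h (F : {set {set 'I_n}}) :=
  ([set Y in powerset E | a |: Y \in F],
   [set Y in powerset E | a |: (c |: Y) \in F]).
rewrite -cE -card_powerset.
apply: leq_trans (card_subset_pairs _).
rewrite -[X in X <= _](card_in_imset (f := h)).
  apply: subset_leq_card; apply/subsetP => p /imsetP[F].
  rewrite inE => /andP[mF _] ->; rewrite inE /=; apply/andP; split.
    apply/subsetP => Y; rewrite !inE => /andP[-> YF] /=.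
    apply: maximal_intersectingS mF YF _; apply: setUS; exact: subsetUr.
  by apply/subsetP => Y; rewrite inE => /andP[].
move=> F G /=; rewrite !inE => /andP[mF abF] /andP[mG abG] [/setP e0 /setP e1].
have aFG (S : {set 'I_n}) : a \in S -> (S \in F) = (S \in G).
  move=> aS; case: (boolP (b \in S)) => bS.
    have sabS : [set a; b] \subset S by rewrite subUset !sub1set aS.
    by rewrite !(maximal_intersectingS _ _ sabS).
  case: (boolP (c \in S)) => cS.
    have := e1 (S :\ a :\ c); rewrite !inE.
    have -> : S :\ a :\ c \subset E.
      apply/subsetP => x; rewrite !inE !negb_or => /and3P[-> -> xS].
      by rewrite /= andbT; apply: contraNneq bS => <-.
    by rewrite /= setD1K ?setD1K // !inE ca cS.
  have := e0 (S :\ a); rewrite !inE.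
  have -> : S :\ a \subset E.
    apply/subsetP => x; rewrite !inE !negb_or => /andP[-> xS] /=.
    by apply/andP; split; [apply: contraNneq bS | apply: contraNneq cS] => <-.
  by rewrite /= setD1K.
apply/setP => S; case: (boolP (a \in S)) => [|aS]; first exact: aFG.
apply: negb_inj; rewrite -!maximal_intersectingC //.
by apply: aFG; rewrite inE.
Qed.

(** * Colourings avoiding a family *)

Definition avoiding_colourings n (F : {set {set 'I_n}}) :
  {set {ffun 'I_n -> 'I_3}} :=
  [set f : {ffun 'I_n -> 'I_3} | [forall c, f @^-1: [set c] \notin F]].

(** Once a member [S] is the class of a given colour, the other two colours are free on [~: S],
    which gives [2 ^ (n - #|S|)] colourings. None is counted twice: two classes of one colouring are
    disjoint, while members of [F] meet. *)
Lemma mass_colourings n (F : {set {set 'I_n}}) :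
  intersecting F -> 3 * mass F + #|avoiding_colourings F| <= 3 ^ n.
Proof.
move=> iF; have := cardsC (avoiding_colourings F).
rewrite card_ffun !card_ord addnC => <-; rewrite leq_add2r.
have -> : 3 * mass F = \sum_(p : 'I_3 * {set 'I_n} | p.2 \in F) 2 ^ (n - #|p.2|).
  transitivity (\sum_(c < 3) mass F); first by rewrite sum_nat_const card_ord.
  by rewrite /mass pair_big.
rewrite -sum1_card big_mkcond /=.
pose Q (p : 'I_3 * {set 'I_n}) (f : {ffun 'I_n -> 'I_3}) :=
  (p.2 \in F) && (f @^-1: [set p.1] == p.2).
apply: leq_trans (sum_pred_packing (P := mem (~: avoiding_colourings F))
  (Q := Q) (fun=> 1) _ _).
- apply: leq_sum => -[c S] _ /=; case: ifP => // SF.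
  rewrite (eq_bigl (fun f : {ffun 'I_n -> 'I_3} => f @^-1: [set c] == S));
    last first.
    by move=> f; rewrite /Q SF.
  rewrite sum1dep_card -card_setC -card_powerset.
  have [dc ec ed] : [/\ ordS c != c, ordS (ordS c) != c & ordS (ordS c) != ordS c].
    by case: c => [[|[|[|]]]].
  apply: leq_trans (leq_imset_card
    (fun f : {ffun 'I_n -> 'I_3} => f @^-1: [set ordS c]) _).
  apply: subset_leq_card; apply/subsetP => Y; rewrite inE => /subsetP sY.
  apply/imsetP; exists [ffun x => if x \in S then c else
                          if x \in Y then ordS c else ordS (ordS c)].
    rewrite inE; apply/eqP/setP => x; rewrite in_set in_set1 ffunE.
    by do 2?case: ifP => _; rewrite ?eqxx ?(negPf dc) ?(negPf ec).
  apply/setP => x; rewrite in_set in_set1 ffunE.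
  case: ifP => xS; last by case: ifP => _; rewrite ?eqxx ?(negPf ed).
  by rewrite eq_sym (negPf dc); apply/negbTE/negP => /sY; rewrite inE xS.
- move=> [c S] f /andP[/= SF /eqP fS]; rewrite !inE; apply/forallPn.
  by exists c; rewrite negbK fS.
- move=> [c S] [d T] f /andP[/= SF /eqP fS] /andP[/= TF /eqP fT].
  have := intersectingP _ iF _ _ SF TF; rewrite -fS -fT.
  by case/set0Pn => x; rewrite !inE => /andP[/eqP <- /eqP <-].
Qed.

(* Walk from a nonmember [S] to the member [~: S] by toggling the elements of the
   ground set in increasing order.  The walk enters [F] at some step, and that
   step together with the set reached just before it determines [S]. *)
Lemma card_pivotal n (F : {set {set 'I_n}}) : 0 < n ->
  maximal_intersecting F ->
  2 ^ (n - 1) <= #|[set p : 'I_n * {set 'I_n} |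
                    [&& p.1 \notin p.2, p.2 \notin F & p.1 |: p.2 \in F]]|.
Proof.
move=> n0 mF.
(* Complementation exchanges members and nonmembers, so each kind makes up half of all sets. *)
have cF : #|~: F| = 2 ^ (n - 1).
  have : #|~: F| = #|F|.
    rewrite -(card_imset _ (@setC_inj _)); apply: eq_card => S.
    apply/imsetP/idP => [[A]|SF].
      by rewrite inE => AF ->; rewrite maximal_intersectingC.
    exists (~: S); rewrite ?setCK //.
    by rewrite inE maximal_intersectingC // negbK.
  have := cardsC F; rewrite -cardsT -powersetT card_powerset cardsT card_ord.
  have : 2 ^ n = 2 * 2 ^ (n - 1) by rewrite -expnS; congr (2 ^ _); lia.
  lia.
rewrite -cF.
pose xor (S : {set 'I_n}) k := [set x : 'I_n | (x \in S) (+) (x < k)].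
have xorK S k : xor (xor S k) k = S.
  by apply/setP => x; rewrite !inE -addbA addbb addbF.
apply: leq_trans (leq_imset_card (fun p : 'I_n * {set 'I_n} => xor p.2 p.1) _).
apply: subset_leq_card; apply/subsetP => S; rewrite inE => SF.
have [k kF kF'] : exists2 k : 'I_n, xor S k \notin F & xor S k.+1 \in F.
  case: (boolP [exists k : 'I_n, (xor S k \notin F) && (xor S k.+1 \in F)]).
    by case/existsP => k /andP[]; exists k.
  rewrite negb_exists => /forallP h.
  have /(_ n (leqnn n)) : forall k, k <= n -> xor S k \notin F.
    elim=> [_|k IH kn].
      by rewrite (_ : xor S 0 = S) //; apply/setP => x; rewrite inE addbF.
    have := h (Ordinal kn); rewrite negb_and negbK /=.
    by rewrite (negPf (IH (ltnW kn))).
  rewrite (_ : xor S n = ~: S) ?maximal_intersectingC ?SF //.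
  by apply/setP => x; rewrite !inE ltn_ord addbT.
have xorS : xor S k.+1 = [set x | (x \in xor S k) (+) (x == k)].
  apply/setP => x; rewrite !inE ltnS leq_eqVlt.
  case: (eqVneq x k) => [->|]; first by rewrite eqxx ltnn addbF.
  by rewrite -val_eqE /= => /negPf ->; rewrite addbF.
apply/imsetP; exists (k, xor S k); last by rewrite /= xorK.
(* [F] is closed upwards, so the toggle that enters it must add [k]. *)
have kS : k \notin xor S k.
  apply: contra kF => kS; apply: maximal_intersectingS mF kF' _.
  apply/subsetP => x; rewrite xorS inE.
  by case: eqP => [->|]; rewrite ?kS ?addbF.
rewrite inE /= kS kF /= (_ : k |: xor S k = xor S k.+1) //.
apply/setP => x; rewrite xorS in_setU1 inE.
by case: eqP => [->|]; rewrite ?addbF ?(negPf kS).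
Qed.

(** A pivotal pair (a, S) and a further b give X = S minus b with X outside [F] and its union with
    {a, b} inside. The classes {a, b}, X and the rest then avoid [F]: the first is too small, the
    last is the complement of a member. *)
Lemma leq_card_avoiding_colourings n (F : {set {set 'I_n}}) : 25 <= n ->
  maximal_intersecting F -> (forall S, S \in F -> 2 < #|S|) ->
  3 * 2 ^ n <= #|avoiding_colourings F|.
Proof.
move=> n25 mF F2; have n0 : 0 < n by lia.
have := card_pivotal n0 mF; set J := [set p | _] => cJ.
pose E := [set p : 'I_n * 'I_n * {set 'I_n} |
  [&& p.1.1 < p.1.2, p.1.1 \notin p.2, p.1.2 \notin p.2, p.2 \notin F
    & p.1.1 |: (p.1.2 |: p.2) \in F]].
have cJE : #|J| * (n - 1) <= #|E| * 4.
  pose L := [set q : 'I_n * {set 'I_n} * 'I_n | (q.1 \in J) && (q.2 != q.1.1)].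
  have <- : #|L| = #|J| * (n - 1).
    rewrite -sum1_card (eq_bigl (fun q => (q.1 \in J) && (q.2 != q.1.1))); last first.
      by move=> q; rewrite inE.
    rewrite -(pair_big_dep (mem J) (fun p b => b != p.1) (fun _ _ => 1)) /=.
    rewrite -sum_nat_const; apply: eq_bigr => p _.
    by rewrite sum1_card cardC1 card_ord subn1.
  have -> : #|E| * 4 = #|setX E [set: bool * bool]|.
    by rewrite cardsX cardsT card_prod card_bool.
  (* Each triple of [E] arises at most four times: one Boolean tells which of its two points is the
     pivot, the other whether the second point was in S. *)
  pose g (r : 'I_n * 'I_n * {set 'I_n} * (bool * bool)) :=
    let: ((a, b), X, (c, d)) := r in
    let: (a', b') := if c then (a, b) else (b, a) in
    ((a', if d then b' |: X else X), b').
  apply: leq_trans (leq_imset_card g _).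
  apply: subset_leq_card; apply/subsetP => -[[a S] b].
  rewrite !inE /= => /andP[/and3P[aS SF aSF] ba].
  have SbF : S :\ b \notin F.
    by apply: contra SF => /(maximal_intersectingS mF); apply; exact: subD1set.
  have abSF : a |: (b |: S :\ b) \in F.
    apply: maximal_intersectingS mF aSF _; apply: setUS.
    by apply/subsetP => x; rewrite !inE; case: eqP.
  have rS : S = if b \in S then b |: S :\ b else S :\ b.
    case: ifP => [/setD1K -> //|/negbT bS].
    by apply/setP => x; rewrite !inE; case: eqP => // ->; rewrite (negPf bS).
  have [ab|ltba] : a < b \/ b < a.
    by case: (ltngtP a b) => [| |/val_inj ab]; [left|right|rewrite ab eqxx in ba].
  - apply/imsetP; exists ((a, b), S :\ b, (true, b \in S)); last by rewrite /= -rS.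
    by rewrite !inE /= ab (negPf aS) eqxx /= andbF SbF abSF.
  - apply/imsetP; exists ((b, a), S :\ b, (false, b \in S)); last by rewrite /= -rS.
    by rewrite !inE /= ltba (negPf aS) eqxx /= andbF SbF setUCA abSF.
have cE : #|E| <= #|avoiding_colourings F|.
  pose i1 : 'I_3 := inord 1; pose i2 : 'I_3 := inord 2.
  pose h (p : 'I_n * 'I_n * {set 'I_n}) : {ffun 'I_n -> 'I_3} :=
    [ffun x => if x \in [set p.1.1; p.1.2] then ord0
               else if x \in p.2 then i1 else i2].
  have [n01 n02 n12] : [/\ ord0 != i1, ord0 != i2 & i1 != i2].
    by rewrite -!val_eqE /= !inordK.
  have h0 p : h p @^-1: [set ord0] = [set p.1.1; p.1.2].
    apply/setP => x; rewrite in_set in_set1 ffunE.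
    case: ifP => _; first by rewrite eqxx.
    by case: ifP => _; rewrite eq_sym ?(negPf n01) ?(negPf n02).
  have h1 p : p \in E -> h p @^-1: [set i1] = p.2.
    rewrite inE => /and5P[_ pa pb _ _].
    apply/setP => x; rewrite in_set in_set1 ffunE.
    case: ifP => [|_]; last by case: ifP => _; rewrite ?eqxx // eq_sym (negPf n12).
    by rewrite (negPf n01) !inE => /orP[] /eqP ->; rewrite ?(negPf pa) ?(negPf pb).
  rewrite -[X in X <= _](card_in_imset (f := h)).
    apply: subset_leq_card; apply/subsetP => f /imsetP[p pE ->{f}].
    rewrite inE; apply/forallP => c.
    case: (eqVneq c ord0) => [->|c0].
      rewrite h0; apply/negP => /F2.
      by rewrite cards2; case: eqP.
    case: (eqVneq c i1) => [->|c1].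
      by rewrite h1 //; move: pE; rewrite inE => /and5P[].
    have -> : c = i2.
      apply: val_inj; rewrite /= inordK //; move: c0 c1; rewrite -!val_eqE /= inordK //.
      by case: c => [[|[|[|]]]].
    rewrite -maximal_intersectingC //.
    apply: maximal_intersectingS mF (_ : p.1.1 |: (p.1.2 |: p.2) \in F) _.
      by move: pE; rewrite inE => /and5P[].
    apply/subsetP => x; rewrite !in_set in_set1 ffunE !inE orbA.
    by case: ifP => [_|_] /=; rewrite ?n02 // => ->; rewrite n12.
  move=> [[a b] S] [[a' b'] S'] pE pE' ff.
  have := h1 _ pE; rewrite ff h1 //= => eS.
  have := h0 ((a, b), S); rewrite ff h0 /= => /setP eD.
  move: pE pE'; rewrite !inE /= => /andP[ltab _] /andP[ltab' _].
  have := eD a; have := eD b; rewrite !inE !eqxx orbT /=.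
  rewrite eS => /orP[] /eqP eb /orP[] /eqP ea; rewrite ea eb ?ltnn // in ltab *.
  by have := ltn_trans ltab ltab'; rewrite ltnn.
have : 2 ^ n = 2 * 2 ^ (n - 1) by rewrite -expnS; congr (2 ^ _); lia.
(* This is where [25 <= n] enters: a quarter of 24 times [2 ^ (n - 1)] is [3 * 2 ^ n]. *)
have : 2 ^ (n - 1) * 24 <= #|J| * (n - 1) by apply: leq_mul => //; lia.
by move: cJE cE; set x := 2 ^ n; set y := 2 ^ (n - 1); lia.
Qed.

(** * Families containing a two-element set *)

(** The colours 0, 1, 2 sum to 3, so for distinct [i] and [j] this is the remaining colour. *)
Definition third (i j : 'I_3) : 'I_3 := inord (3 - i - j).

Lemma thirdP (i j : 'I_3) : i != j ->
  [/\ third i j != i, third i j != j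
    & forall c, c != i -> c != j -> c = third i j].
Proof.
rewrite -val_eqE => /= ij; have [ltj lti] := (ltn_ord j, ltn_ord i).
have v : third i j = 3 - i - j :> nat by rewrite inordK //; lia.
split; rewrite -?val_eqE /= ?v; try lia.
move=> c; rewrite -!val_eqE /= => ci cj; apply: val_inj; rewrite /= v.
by have := ltn_ord c; lia.
Qed.

Definition crossing_pairs n (F : {set {set 'I_n}}) (a b : 'I_n) :=
  [set p : {set 'I_n} * {set 'I_n} |
    [&& p.1 \subset p.2, p.2 \subset ~: [set a; b],
        a |: p.1 \notin F & a |: p.2 \in F]].

(** A pair (X, W) yields the classes [a |: X], [~: (a |: W)] and W minus X. The second is the
    complement of a member, and the third is disjoint from the member [[set a; b]]. The factor 6
    counts the ways to name the three colours. *)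
Lemma leq_crossing_colourings n (F : {set {set 'I_n}}) (a b : 'I_n) :
  maximal_intersecting F -> a != b -> [set a; b] \in F ->
  6 * #|crossing_pairs F a b| <= #|avoiding_colourings F|.
Proof.
move=> mF ab abF; set Phi := crossing_pairs F a b.
pose IJ := [set ij : 'I_3 * 'I_3 | ij.2 != ij.1].
have cIJ : #|IJ| = 6.
  rewrite -sum1_card (eq_bigl (fun q => true && (q.2 != q.1))); last first.
    by move=> q; rewrite inE.
  rewrite -(pair_big_dep predT (fun i j => j != i) (fun _ _ => 1)) /=.
  rewrite (eq_bigr (fun=> 2)) ?sum_nat_const ?card_ord // => i _.
  by rewrite sum1_card cardC1 card_ord.
rewrite -cIJ -cardsX.
pose D := ~: [set a; b].
pose h (q : 'I_3 * 'I_3 * ({set 'I_n} * {set 'I_n})) : {ffun 'I_n -> 'I_3} :=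
  [ffun x => if x \in a |: q.2.1 then q.1.1 else
             if x \in ~: (a |: q.2.2) then q.1.2 else third q.1.1 q.1.2].
have hi q : q \in setX IJ Phi -> h q @^-1: [set q.1.1] = a |: q.2.1.
  case: q => [[i j] [X W]]; rewrite !inE eq_sym /= => /andP[ij _].
  have [n1 n2 _] := thirdP ij.
  apply/setP => x; rewrite in_set in_set1 ffunE /=.
  case: ifP => _; first by rewrite eqxx.
  by case: ifP => _; rewrite ?(negPf n1) // eq_sym (negPf ij).
have hj q : q \in setX IJ Phi -> h q @^-1: [set q.1.2] = ~: (a |: q.2.2).
  case: q => [[i j] [X W]]; rewrite !inE eq_sym /= => /andP[ij /and4P[XW _ _ _]].
  have [n1 n2 _] := thirdP ij.
  apply/setP => x; rewrite in_set in_set1 ffunE /= in_setC.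
  case: ifP => [xX|_].
    by rewrite (negPf ij) (subsetP (setUS _ XW) _ xX).
  by case: ifP => _; rewrite ?eqxx ?(negPf n2).
rewrite -[X in X <= _](card_in_imset (f := h)).
  apply: subset_leq_card; apply/subsetP => f /imsetP[q qE ->{f}].
  rewrite inE; apply/forallP => c.
  have := qE; case: q qE => [[i j] [X W]] qE.
  rewrite !inE eq_sym /= => /andP[ij /and4P[XW WD XF WF]].
  have [n1 n2 n3] := thirdP ij.
  case: (eqVneq c i) => [->|ci]; first by rewrite (hi _ qE).
  case: (eqVneq c j) => [->|cj].
    by rewrite (hj _ qE) maximal_intersectingC // negbK.
  have : ~: [set a; b] \notin F by rewrite maximal_intersectingC // negbK.
  apply: contra => /(maximal_intersectingS mF); apply.
  have bW : b \notin W.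
    by apply/negP => /(subsetP WD); rewrite !inE eqxx orbT.
  apply/subsetP => x; rewrite in_set in_set1 ffunE /=.
  case: ifP => [_|xX]; first by rewrite eq_sym (negPf ci).
  case: ifP => [_|xW]; first by rewrite eq_sym (negPf cj).
  move=> _; move/negbT: xX; move/negbT: xW.
  rewrite !inE !negb_or => xW /andP[xa _]; move: xW; rewrite xa /= negbK.
  by apply: contraTneq => ->.
(* The first class contains [a] and the second contains [b], so the colours of these two points
   recover the naming, and then the classes recover (X, W). *)
have fa q : h q a = q.1.1 by rewrite ffunE setU11.
have fb q : q \in setX IJ Phi -> h q b = q.1.2.
  move=> qE; have /setP/(_ b) := hj _ qE.
  case: q qE => [[i j] [X W]]; rewrite !inE /= => /andP[_ /and4P[_ WD _ _]].
  have bW : b \notin W by apply/negP => /(subsetP WD); rewrite !inE eqxx orbT.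
  by rewrite (eq_sym b a) (negPf ab) (negPf bW) => /eqP.
move=> p q pE qE hpq; have eqi : p.1.1 = q.1.1 by rewrite -!fa hpq.
have eqj : p.1.2 = q.1.2 by rewrite -!fb // hpq.
have eX : a |: p.2.1 = a |: q.2.1 by rewrite -!hi // hpq eqi.
have eW : a |: p.2.2 = a |: q.2.2 by apply: setC_inj; rewrite -!hj // hpq eqj.
have aN r : r \in setX IJ Phi -> (a \notin r.2.1) * (a \notin r.2.2).
  case: r => [[i j] [X W]]; rewrite !inE /= => /andP[_ /and4P[XW WD _ _]].
  have aW : a \notin W by apply/negP => /(subsetP WD); rewrite !inE eqxx.
  by split=> //; apply: contra aW; exact: subsetP.
have {}eX : p.2.1 = q.2.1 by rewrite -(setU1K (aN _ pE).1) eX setU1K // (aN _ qE).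
have {}eW : p.2.2 = q.2.2 by rewrite -(setU1K (aN _ pE).2) eW setU1K // (aN _ qE).
case: p q eqi eqj eX eW {pE qE hpq} => [[i j] [X W]] [[i' j'] [X' W']] /=.
by move=> -> -> -> ->.
Qed.

(* With D the complement of [set a; b], every nonempty Z in D gives a pair
   (set0, Z) or (Z, D), and every Z in D :\ y with two elements or more gives a
   further pair ([set x], Z) or (Z, D :\ y). *)
Lemma leq_card_crossing_pairs n (F : {set {set 'I_n}}) (a b y : 'I_n) :
  maximal_intersecting F -> a != b -> [set a] \notin F -> [set b] \notin F ->
  y \notin [set a; b] -> [set b; y] \notin F ->
  #|[set x in ~: [set a; b] | [set a; x] \in F]| <= 1 ->
  2 ^ (n - 2) + 2 ^ (n - 3) <= #|crossing_pairs F a b| + n - 1.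
Proof.
move=> mF ab aF bF yab byF cP; set Phi := crossing_pairs F a b.
pose D := ~: [set a; b]; pose E := D :\ y.
have yD : y \in D by rewrite inE.
have cD : #|D| = n - 2 by rewrite card_setC cards2 ab.
have cE : #|E| = n - 3.
  by have := cardsD1 y D; rewrite yD cD -/E; lia.
have D0 : D != set0 by apply/set0Pn; exists y.
have n3 : 2 < n by move: D0; rewrite -card_gt0 cD; lia.
(* [low] separates the two kinds of pairs, so that they can be counted independently. *)
pose low := [set p : {set 'I_n} * {set 'I_n} | (p.1 == set0) || (p.2 == D)].
have c1 : 2 ^ (n - 2) - 1 <= #|Phi :&: low|.
  have -> : 2 ^ (n - 2) - 1 = #|powerset D :\ set0|.
    have := cardsD1 set0 (powerset D).
    by rewrite inE sub0set card_powerset cD; lia.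
  apply: leq_trans (leq_imset_card (fun p : {set 'I_n} * {set 'I_n} =>
    if p.1 == set0 then p.2 else p.1) _).
  apply: subset_leq_card; apply/subsetP => Z; rewrite !inE => /andP[Z0 ZD].
  apply/imsetP; case: (boolP (a |: Z \in F)) => aZ.
    exists (set0, Z); last by rewrite /= eqxx.
    by rewrite !inE /= sub0set ZD setU0 aF aZ eqxx.
  exists (Z, D); last by rewrite /= (negPf Z0).
  rewrite !inE /= ZD subxx aZ eqxx orbT andbT /=.
  rewrite (_ : a |: D = ~: [set b]) ?maximal_intersectingC //.
  by apply/setP => x; rewrite !inE; case: (eqVneq x a) => [->|].
have c2 : 2 ^ (n - 3) <= #|Phi :\: low| + (n - 3) + 1.
  pose L := [set Z in powerset E | 1 < #|Z|].
  have cL : 2 ^ (n - 3) <= #|L| + (n - 3) + 1.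
    rewrite -{1}cE -card_powerset.
    have sL : powerset E \subset L :|: ((@set1 _) @: E) :|: [set set0].
      apply/subsetP => Z; rewrite !inE => ZE; rewrite ZE /=.
      case: (ltngtP #|Z| 1) => // [|/eqP/cards1P[x Zx]].
        by rewrite ltnS leqn0 cards_eq0 => ->; rewrite orbT.
      by rewrite Zx imset_f //= -sub1set -Zx.
    apply: leq_trans (subset_leq_card sL) _.
    rewrite (leq_trans (leq_card_setU _ _)) // cards1 leq_add2r.
    rewrite (leq_trans (leq_card_setU _ _)) // leq_add2l -cE.
    exact: leq_imset_card.
  apply: leq_trans cL _; rewrite !leq_add2r.
  (* As [Z] has at least two elements, a singleton first component shows that [Z] is the second
     one. *)
  apply: leq_trans (leq_imset_card (fun p : {set 'I_n} * {set 'I_n} =>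
    if #|p.1| == 1 then p.2 else p.1) _).
  apply: subset_leq_card; apply/subsetP => Z; rewrite !inE => /andP[ZE Z1].
  have ZD : Z \subset D by apply: subset_trans ZE _; exact: subD1set.
  have yZ : y \notin Z by apply/negP => /(subsetP ZE); rewrite !inE eqxx.
  have ZnD : Z != D by apply: contraNneq yZ => ->.
  have EnD : E != D by apply: contraTneq yD => <-; rewrite !inE eqxx.
  apply/imsetP; case: (boolP (a |: Z \in F)) => aZ.
    (* At most one point of [D] forms a member with [a], and [Z] has two points. *)
    have [x xZ axF] : exists2 x, x \in Z & [set a; x] \notin F.
      apply/exists_inP; apply: contraLR Z1; rewrite negb_exists_in -leqNgt.
      move=> /forall_inP ZF.
      apply: leq_trans cP; apply: subset_leq_card; apply/subsetP => x xZ.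
      by rewrite inE (subsetP ZD _ xZ) /=; have := ZF _ xZ; rewrite negbK.
    exists ([set x], Z); last by rewrite /= cards1.
    rewrite !inE /= sub1set xZ ZD axF aZ (negPf ZnD) !andbT orbF.
    by apply/set0Pn; exists x; rewrite inE.
  exists (Z, E); last by rewrite /=; case: eqP Z1 => // ->.
  rewrite !inE /= ZE (negPf EnD) subD1set aZ orbF /=.
  rewrite (_ : a |: E = ~: [set b; y]) ?(maximal_intersectingC _ mF) ?byF.
    by rewrite andbT; apply: contraTneq Z1 => ->; rewrite cards0.
  have ya : (y == a) = false by apply: contraNF yab => /eqP ->; rewrite !inE eqxx.
  apply/setP => x; rewrite !inE; case: (eqVneq x a) => [->|] /=.
    by rewrite eq_sym (eq_sym a) ya orbF eq_sym ab.
  by rewrite negb_or andbC.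
have := cardsID low Phi.
by move: c1 c2; set u := 2 ^ _; set v := 2 ^ _; lia.
Qed.

(** Six times the number of crossing pairs is at least [18 * 2 ^ (n - 3)] up to a term linear in
    [n]; dividing the colouring inequality by 3 leaves [6 * 2 ^ (n - 3)]. *)
Lemma mass_pair n (F : {set {set 'I_n}}) (a b x y : 'I_n) :
  maximal_intersecting F -> (forall c, [set c] \notin F) ->
  a != b -> [set a; b] \in F ->
  x != a -> [set a; x] \notin F -> y != b -> [set b; y] \notin F ->
  mass F + 6 * 2 ^ (n - 3) <= 3 ^ (n - 1) + 2 * n.
Proof.
move=> mF F1.
(* If [a] has two further partners z, z' and [b] has a partner w, then w equals both, since {b, w}
   must meet {a, z} and {a, z'}. So the bound on partners holds for [a] or for [b]. *)
wlog cP : a b x y / #|[set z in ~: [set a; b] | [set a; z] \in F]| <= 1.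
  move=> hw ab abF xa axF yb byF.
  case: (leqP #|[set z in ~: [set a; b] | [set a; z] \in F]| 1) => [cP|].
    exact: hw cP ab abF xa axF yb byF.
  case/card_gt1P => z [z' []]; rewrite [z \in _]in_set [z' \in _]in_set.
  move=> /andP[zD azF] /andP[z'D az'F] zz'.
  apply: (hw b a y x) => //; [|by rewrite eq_sym|by rewrite setUC].
  rewrite leqNgt; apply/negP => /card_gt1P[w [w' []]].
  rewrite [w \in _]in_set => /andP[wD bwF] _ _.
  have key u v : u \in ~: [set a; b] -> [set a; u] \in F ->
      v \in ~: [set b; a] -> [set b; v] \in F -> u = v.
    rewrite !inE !negb_or => /andP[ua ub] auF /andP[vb va] bvF.
    case/andP: mF => /intersectingP iF _; have /set0Pn[t] := iF _ _ auF bvF.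
    rewrite !inE => /andP[/orP[]/eqP-> /orP[]/eqP e] //.
    - by rewrite e eqxx in ab.
    - by rewrite e eqxx in va.
    - by rewrite e eqxx in ub.
  by case/eqP: zz'; rewrite (key z w zD azF wD bwF) (key z' w z'D az'F wD bwF).
move=> ab abF xa axF yb byF.
have ya : y != a by apply: contraNneq byF => ->; rewrite setUC.
have := @leq_card_crossing_pairs _ F a b y mF ab (F1 a) (F1 b).
rewrite !inE negb_or ya yb => /(_ isT byF cP) h1.
have h2 := leq_crossing_colourings mF ab abF.
have h3 := mass_colourings (proj1 (andP mF)).
have n3 : 2 < n.
  have : 0 < #|~: [set a; b]|.
    by rewrite card_gt0; apply/set0Pn; exists y; rewrite !inE negb_or ya.
  by rewrite card_setC cards2 ab; lia.
have e2 : 2 ^ (n - 2) = 2 * 2 ^ (n - 3) by rewrite -expnS; congr (2 ^ _); lia.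
have e3 : 3 ^ n = 3 * 3 ^ (n - 1) by rewrite -expnS; congr (3 ^ _); lia.
move: h1 h2 h3; rewrite e2 e3; set u := 2 ^ _; set v := 3 ^ _; lia.
Qed.

(** * Hilton-Milner families *)

Definition punctured_star n (a : 'I_n) : {set {set 'I_n}} :=
  [set S : {set 'I_n} | a \in S] :\ [set a].

Definition hilton_milner n (a : 'I_n) : {set {set 'I_n}} :=
  ~: [set a] |: punctured_star a.

Definition two_sets n (a : 'I_n) : {set {set 'I_n}} :=
  [set [set a; b] | b in [set~ a]].

Lemma leq_expl m p k : m <= p -> m ^ k <= p ^ k.
Proof. by case: k => // k le; rewrite leq_exp2r. Qed.

Lemma mass_punctured_star n (a : 'I_n) :
  mass (punctured_star a) = 3 ^ (n - 1) - 2 ^ (n - 1).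
Proof.
rewrite -(mass_star a) /mass [in RHS](big_setD1 [set a]) /=; last by rewrite !inE.
by rewrite cards1 addKn.
Qed.

(** The summand 2 in [Mstar] is the mass contributed by [~: [set a]], so [Mstar n] is the mass of a
    Hilton-Milner family. *)
Lemma exp2_Mstar n (a : 'I_n) : 2 ^ Mstar n = 4 * 2 ^ mass (punctured_star a).
Proof. by rewrite mass_punctured_star /Mstar addnC expnD. Qed.

Lemma setC1_notin_star n (a : 'I_n) : ~: [set a] \notin punctured_star a.
Proof. by rewrite !inE eqxx andbF. Qed.

Lemma weight_setC1 n (a : 'I_n) : weight (~: [set a]) = 3.
Proof.
rewrite /weight card_setC cards1; have := ltn_ord a => an.
by rewrite (_ : n - (n - 1) = 1) //; lia.
Qed.

Lemma sum_hilton_milner n (a : 'I_n) :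
  \sum_(F : {set {set 'I_n}} |
         ([set ~: [set a]] \subset F) && (F \subset hilton_milner a))
    \prod_(S in F) weight S = 3 * 2 ^ mass (punctured_star a).
Proof.
rewrite sum_prod_between; last by rewrite sub1set setU11.
rewrite big_set1 weight_setC1 /hilton_milner setU1K ?setC1_notin_star //.
by rewrite prod_weightS.
Qed.

(** A member missing [a] has to meet every [[set a; x]], hence contains every [x] other than [a]. *)
Lemma maximal_sub_hilton_milner n (F : {set {set 'I_n}}) (a : 'I_n) :
  maximal_intersecting F -> [set a] \notin F ->
  (forall x, x != a -> [set a; x] \in F) -> F \subset hilton_milner a.
Proof.
move=> mF aF h; apply/subsetP => S SF; rewrite in_setU1 in_setD1 in_set.
case: (boolP (a \in S)) => aS.
  by rewrite andbT orbC; apply/orP; left; apply: contraNneq aF => <-.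
rewrite andbF orbF; apply/eqP/setP => x; rewrite !inE.
case: (eqVneq x a) => [->|xa]; first by rewrite (negPf aS).
case/andP: mF => /intersectingP iF _; have /set0Pn[t] := iF _ _ (h _ xa) SF.
by rewrite !inE => /andP[/orP[]/eqP -> //]; rewrite (negPf aS).
Qed.

(** The empty kernel is used twice: it keeps singletons out of the maximal extension [G], and inside
    a Hilton-Milner family it forces [~: [set a]] into [F], the only set there that misses [a]. *)
Lemma intersecting_trichotomy n (F : {set {set 'I_n}}) : 25 <= n ->
  intersecting F -> ker F = set0 ->
  [|| [exists a, ([set ~: [set a]] \subset F) && (F \subset hilton_milner a)],
      [exists G : {set {set 'I_n}},
         [&& maximal_intersecting G, mass G + 2 ^ n <= 3 ^ (n - 1) & F \subset G]]
    | [exists p : 'I_n * 'I_n * {set {set 'I_n}},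
         [&& p.1.1 != p.1.2, maximal_intersecting p.2,
             [set p.1.1; p.1.2] \in p.2,
             mass p.2 + 6 * 2 ^ (n - 3) <= 3 ^ (n - 1) + 2 * n & F \subset p.2]]].
Proof.
move=> n25 iF kF; have n0 : 0 < n by lia.
have [G mG sFG] := maximal_intersecting_extension n0 iF.
have iG := intersectingP _ (proj1 (andP mG)).
have avoid a : exists2 S, S \in F & a \notin S.
  apply/exists_inP; rewrite -negb_forall_in; apply/negP => /forall_inP h.
  have : a \in ker F by apply/bigcapP.
  by rewrite kF inE.
have G1 a : [set a] \notin G.
  apply/negP => aG; have [S SF aS] := avoid a.
  have /set0Pn[x] := iG _ _ aG (subsetP sFG _ SF).
  by rewrite !inE => /andP[/eqP -> aS']; rewrite aS' in aS.
have HM a : (forall x, x != a -> [set a; x] \in G) ->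
    ([set ~: [set a]] \subset F) && (F \subset hilton_milner a).
  move=> h; have sGH := maximal_sub_hilton_milner mG (G1 a) h.
  rewrite (subset_trans sFG sGH) andbT sub1set; have [S SF aS] := avoid a.
  have := subsetP sGH _ (subsetP sFG _ SF).
  by rewrite in_setU1 in_setD1 in_set (negPf aS) andbF orbF => /eqP <-.
case: (boolP [forall S in G, 2 < #|S|]) => [/forall_inP G2|].
  apply/orP; right; apply/orP; left; apply/existsP; exists G; rewrite mG sFG /= andbT.
  have h1 := leq_card_avoiding_colourings n25 mG G2.
  have h2 := mass_colourings (proj1 (andP mG)).
  have e3 : 3 ^ n = 3 * 3 ^ (n - 1) by rewrite -expnS; congr (3 ^ _); lia.
  move: h1 h2; rewrite e3; set u := 2 ^ _; set v := 3 ^ _; lia.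
rewrite negb_forall_in => /exists_inP[S SG]; rewrite -leqNgt => S2.
have /cards2P[a [b [ab eS]]] : #|S| == 2.
  have S0 : #|S| != 0.
    by rewrite cards_eq0; have := iG _ _ SG SG; rewrite setIid.
  have S1 : #|S| != 1.
    by apply/negP => /cards1P[x Sx]; have := G1 x; rewrite -Sx SG.
  by case: #|S| S0 S1 S2 => [|[|[]]].
have abG : [set a; b] \in G by rewrite -eS.
case: (boolP [forall (x | x != a), [set a; x] \in G]) => [/forall_inP h|].
  by apply/orP; left; apply/existsP; exists a; apply: HM.
rewrite negb_forall_in => /exists_inP[x xa axG].
case: (boolP [forall (x | x != b), [set b; x] \in G]) => [/forall_inP h|].
  by apply/orP; left; apply/existsP; exists b; apply: HM.
rewrite negb_forall_in => /exists_inP[y yb byG].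
apply/orP; right; apply/orP; right; apply/existsP; exists (a, b, G).
by rewrite /= ab mG abG sFG andbT; exact: (mass_pair mG G1 ab abG xa axG yb byG).
Qed.

(** A union bound over the three cases, where the subfamilies of each [G] sum to [2 ^ mass G]. *)
Lemma Rsum_split n : 25 <= n ->
  Rsum n <= n * (3 * 2 ^ (3 ^ (n - 1) - 2 ^ (n - 1)))
    + (\sum_(G : {set {set 'I_n}} |
         maximal_intersecting G && (mass G + 2 ^ n <= 3 ^ (n - 1))) 2 ^ mass G
    + \sum_(p : 'I_n * 'I_n * {set {set 'I_n}} |
         [&& p.1.1 != p.1.2, maximal_intersecting p.2,
             [set p.1.1; p.1.2] \in p.2
           & mass p.2 + 6 * 2 ^ (n - 3) <= 3 ^ (n - 1) + 2 * n]) 2 ^ mass p.2).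
Proof.
move=> n25; rewrite /Rsum.
apply: leq_trans (sum_predU_leq _ _) _.
  by move=> F /and3P[_ iF /eqP kF]; exact: (intersecting_trichotomy n25 iF kF).
apply: leq_add.
  apply: leq_trans (sum_pred_cover (Q := fun (a : 'I_n) (F : {set {set 'I_n}}) =>
    ([set ~: [set a]] \subset F) && (F \subset hilton_milner a)) _ _) _ => //.
  rewrite (eq_bigr (fun=> 3 * 2 ^ (3 ^ (n - 1) - 2 ^ (n - 1)))).
    by rewrite sum_nat_const card_ord.
  by move=> a _; rewrite sum_hilton_milner mass_punctured_star.
apply: leq_trans (sum_predU_leq _ _) _; first by move=> F; exact: id.
apply: leq_add.
  apply: leq_trans (sum_pred_cover (Q := fun G F : {set {set 'I_n}} =>
    [&& maximal_intersecting G, mass G + 2 ^ n <= 3 ^ (n - 1) & F \subset G])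
    _ _) _ => //.
  rewrite [X in _ <= X]big_mkcond; apply: leq_sum => G _ /=.
  case: ifP => [/andP[-> ->]|/negbT h] /=.
    by rewrite sum_prod_subsets prod_weightS.
  rewrite big_pred0 // => F; apply/negbTE; apply: contra h.
  by case/and3P => -> -> _.
apply: leq_trans (sum_pred_cover (Q := fun (p : 'I_n * 'I_n * {set {set 'I_n}})
    (F : {set {set 'I_n}}) =>
  [&& p.1.1 != p.1.2, maximal_intersecting p.2, [set p.1.1; p.1.2] \in p.2,
      mass p.2 + 6 * 2 ^ (n - 3) <= 3 ^ (n - 1) + 2 * n & F \subset p.2])
  _ _) _ => //.
rewrite [X in _ <= X]big_mkcond; apply: leq_sum => p _ /=.
case: ifP => [/and4P[-> -> -> ->]|/negbT h] /=.
  by rewrite sum_prod_subsets prod_weightS.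
rewrite big_pred0 // => F; apply/negbTE; apply: contra h.
by case/and5P => -> -> -> -> _.
Qed.

(** * Upper bound *)

Lemma linear_leq_exp2 n : 25 <= n -> 12 * n <= 2 ^ (n - 3).
Proof.
move=> n25; have lt : n - 13 < 2 ^ (n - 13) by rewrite ltn_expl.
have -> : 2 ^ (n - 3) = 2 ^ (n - 13) * 2 ^ 10 by rewrite -expnD; congr (2 ^ _); lia.
have : (n - 13).+1 * 2 ^ 10 <= 2 ^ (n - 13) * 2 ^ 10 by rewrite leq_mul2r lt orbT.
by apply: leq_trans; lia.
Qed.

(** Raise [2 * 3 ^ 3 <= 4 ^ 3] to the power [4 * n]; the remaining exponent only uses [3 <= 4]. *)
Lemma exp3_leq_exp4 n h : 12 * n <= h -> 2 ^ (4 * n) * 3 ^ h <= 4 ^ h.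
Proof.
move=> le; rewrite -(subnKC le) [3 ^ _]expnD [4 ^ _]expnD mulnA; apply: leq_mul.
  have -> : 12 * n = 3 * (4 * n) by lia.
  by rewrite !(expnM _ 3) -expnMn; exact: leq_expl.
exact: leq_expl.
Qed.

(** At most [H] families contribute at most X / H^2 each, and X / H is a quarter of
    [2 ^ Mstar n]. *)
Lemma sum_far_families n : 25 <= n ->
  4 * \sum_(G : {set {set 'I_n}} |
         maximal_intersecting G && (mass G + 2 ^ n <= 3 ^ (n - 1))) 2 ^ mass G
  <= 2 ^ Mstar n.
Proof.
move=> n25; have n0 : 0 < n by lia.
pose H := 2 ^ (2 ^ (n - 1)); pose X := 2 ^ (3 ^ (n - 1)).
have H0 : 0 < H by rewrite expn_gt0.
have eH : 2 ^ (2 ^ n) = H * H.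
  by rewrite -expnD addnn -mul2n -expnS; congr (2 ^ (2 ^ _)); lia.
have eM : 2 ^ Mstar n * H = 4 * X.
  rewrite -expnD -[4]/(2 ^ 2) -expnD /Mstar; congr (2 ^ _).
  by have := leq_expl (n - 1) (isT : 2 <= 3); lia.
set s := \sum_(G | _) _.
have : s * (H * H) <= H * X.
  rewrite -eH big_distrl /=.
  apply: leq_trans (_ : #|[set F : {set {set 'I_n}} | maximal_intersecting F]| * X <= _).
    rewrite -sum_nat_const big_mkcond [X in _ <= X]big_mkcond /=.
    apply: leq_sum => G _; rewrite inE; case: (maximal_intersecting G) => //=.
    by case: ifP => // h; rewrite -expnD leq_exp2l.
  by rewrite leq_mul2r card_maximal_intersecting // orbT.
rewrite mulnCA leq_mul2l gtn_eqF //= => sH.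
by rewrite -(leq_pmul2r H0) eM -mulnA leq_mul2l.
Qed.

(** With [h = 2 ^ (n - 3)], there are at most [2 ^ (2 * n)] pairs of points and [3 ^ h] families for
    each, every one contributing at most [X * 2 ^ (2 * n)] over [2 ^ (6 * h) = H * 4 ^ h]. The
    factor [4 ^ h] absorbs [2 ^ (4 * n) * 3 ^ h]. *)
Lemma sum_pair_families n : 25 <= n ->
  4 * \sum_(p : 'I_n * 'I_n * {set {set 'I_n}} |
         [&& p.1.1 != p.1.2, maximal_intersecting p.2,
             [set p.1.1; p.1.2] \in p.2
           & mass p.2 + 6 * 2 ^ (n - 3) <= 3 ^ (n - 1) + 2 * n]) 2 ^ mass p.2
  <= 2 ^ Mstar n.
Proof.
move=> n25; have n0 : 0 < n by lia.
set h := 2 ^ (n - 3).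
pose H := 2 ^ (4 * h); pose X := 2 ^ (3 ^ (n - 1)).
have H0 : 0 < H by rewrite expn_gt0.
have e4 : 4 * h = 2 ^ (n - 1).
  have -> : n - 1 = (n - 3).+2 by lia.
  by rewrite !expnS mulnA.
have eM : 2 ^ Mstar n * H = 4 * X.
  have -> : 4 * X = 2 ^ (2 + 3 ^ (n - 1)) by rewrite expnD.
  rewrite -expnD e4 /Mstar; congr (2 ^ _).
  by have := leq_expl (n - 1) (isT : 2 <= 3); lia.
set s := \sum_(p | _) _.
have sum_le : s * 2 ^ (6 * h) <= 2 ^ (2 * n) * (3 ^ h * (X * 2 ^ (2 * n))).
  rewrite big_distrl /=.
  apply: leq_trans (_ : \sum_(q : 'I_n * 'I_n) 3 ^ h * (X * 2 ^ (2 * n)) <= _); last first.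
    rewrite sum_nat_const card_prod card_ord leq_mul2r; apply/orP; right.
    by rewrite mul2n -addnn expnD; apply: leq_mul; apply: ltnW; exact: ltn_expl.
  rewrite -(pair_big_dep predT (fun (q : 'I_n * 'I_n) (G : {set {set 'I_n}}) =>
    [&& q.1 != q.2, maximal_intersecting G, [set q.1; q.2] \in G
      & mass G + 6 * h <= 3 ^ (n - 1) + 2 * n])
    (fun _ G => 2 ^ mass G * 2 ^ (6 * h))) /=.
  apply: leq_sum => -[a b] _ /=; case: (eqVneq a b) => ab /=.
    by rewrite big_pred0.
  apply: leq_trans (_ : #|[set F : {set {set 'I_n}} |
      maximal_intersecting F & [set a; b] \in F]| * (X * 2 ^ (2 * n)) <= _).
    rewrite -sum_nat_const big_mkcond [X in _ <= X]big_mkcond /=.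
    apply: leq_sum => G _; rewrite inE.
    case: (maximal_intersecting G) => //=; case: ([set a; b] \in G) => //=.
    by case: ifP => // le; rewrite -!expnD leq_exp2l.
  by rewrite leq_mul2r card_maximal_intersecting_pair ?orbT //; lia.
have le34 := exp3_leq_exp4 (linear_leq_exp2 n25).
have e6 : 2 ^ (6 * h) = H * 4 ^ h.
  by rewrite -[4 ^ h]/((2 ^ 2) ^ h) -expnM -expnD; congr (2 ^ _); lia.
have eN : 2 ^ (4 * n) = 2 ^ (2 * n) * 2 ^ (2 * n).
  by rewrite -expnD; congr (2 ^ _); lia.
have : s * H * 4 ^ h <= X * 4 ^ h.
  rewrite -mulnA -e6; apply: leq_trans sum_le _.
  apply: leq_trans (_ : X * (2 ^ (4 * n) * 3 ^ h) <= _).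
    by rewrite eN; apply: eq_leq; ring.
  by rewrite leq_mul2l le34 orbT.
rewrite leq_pmul2r ?expn_gt0 // => sH.
by rewrite -(leq_pmul2r H0) eM -mulnA leq_mul2l.
Qed.

Lemma Rsum_upper n : 25 <= n ->
  4 * Rsum n <= 3 * n * 2 ^ Mstar n + 2 * 2 ^ Mstar n.
Proof.
move=> n25; have n0 : 0 < n by lia.
have := Rsum_split n25.
have := sum_far_families n25; have := sum_pair_families n25.
have := exp2_Mstar (Ordinal n0); rewrite mass_punctured_star.
set M := 2 ^ Mstar n; set Z := 2 ^ (_ - _).
set s := \sum_(p | _) _; set t := \sum_(G | _) _.
move=> eM hs ht hR; rewrite -mulnA [n * M]mulnC.
nia.
Qed.

(** Bernoulli's inequality for (1 - 1/(q+1))^k, cleared of denominators. *)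
Lemma bernoulli_nat q k : q.+1 ^ k * q.+1 <= q.+1 * q ^ k + k * q.+1 ^ k.
Proof.
elim: k => [|k IH]; first by rewrite !expn0 mul1n muln1 mul0n addn0.
have le : q ^ k <= q.+1 ^ k by exact: leq_expl.
rewrite !expnS; move: IH le; set u := q.+1 ^ k; set v := q ^ k => IH le.
apply: leq_trans (_ : q.+1 * (q.+1 * v + k * u) <= _).
  by rewrite -mulnA leq_mul2l IH orbT.
have : q.+1 * v <= q.+1 * u by rewrite leq_mul2l le orbT.
lia.
Qed.

(** When [n * k <= q.+1], the factor (q/(q+1))^k costs at most one of [n] equal terms; this is the
    price of forcing the two-element sets below. *)
Lemma mul_expS_leq n k q : n * k <= q.+1 ->
  n * q.+1 ^ k <= n * q ^ k + q.+1 ^ k.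
Proof.
move=> le; rewrite -(leq_pmul2r (ltn0Sn q)).
have h : n * (q.+1 ^ k * q.+1) <= n * (q.+1 * q ^ k + k * q.+1 ^ k).
  by rewrite leq_mul2l bernoulli_nat orbT.
have h2 : n * k * q.+1 ^ k <= q.+1 * q.+1 ^ k by rewrite leq_mul2r le orbT.
rewrite -mulnA (leq_trans h) // mulnDr mulnDl [n * (k * _)]mulnA.
by apply: leq_add; [rewrite mulnCA mulnC | rewrite [X in _ <= X]mulnC].
Qed.

(** * Lower bound *)

(* Requiring every two-element set through [a] makes the families counted for
   different [a] distinct, at the cost of a factor tending to 1. *)
Definition star_core n (a : 'I_n) : {set {set 'I_n}} :=
  ~: [set a] |: two_sets a.

Lemma two_sets_sub n (a : 'I_n) : two_sets a \subset punctured_star a.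
Proof.
apply/subsetP => S /imsetP[b]; rewrite !inE => ba ->.
rewrite set21 andbT; apply: contraNneq ba => /setP/(_ b).
by rewrite !inE eqxx orbT => <-.
Qed.

Lemma card_two_sets n (a : 'I_n) : #|two_sets a| = n - 1.
Proof.
rewrite card_in_imset ?card_setC ?cards1 // => b c; rewrite !inE => ba ca /setP/(_ b).
by rewrite !inE eqxx orbT (negPf ba) => /esym/eqP.
Qed.

Lemma card_two_set n (a : 'I_n) S : S \in two_sets a -> #|S| = 2.
Proof. by case/imsetP => b; rewrite !inE => ba ->; rewrite cards2 eq_sym ba. Qed.

Lemma exists_notin n (A : {set 'I_n}) : #|A| < n -> exists x, x \notin A.
Proof.
move=> lt; have : ~: A != set0 by rewrite -card_gt0 card_setC subn_gt0.
by case/set0Pn => x; rewrite inE; exists x.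
Qed.

Lemma card_set3_leq n (a b c : 'I_n) : #|[set a; b; c]| <= 3.
Proof.
by rewrite setUC cardsU1 cards2; case: (_ \notin _); case: (_ != _).
Qed.

Lemma hilton_milner_intersecting n (a : 'I_n) (F : {set {set 'I_n}}) : 1 < n ->
  F \subset hilton_milner a -> intersecting F.
Proof.
move=> n1 /subsetP sF.
have ne S : S \in punctured_star a -> S :&: ~: [set a] != set0.
  rewrite !inE -setDE => /andP[Sa aS]; apply: contra Sa.
  by rewrite setD_eq0 subset1 => /orP[//|/eqP S0]; rewrite S0 inE in aS.
apply/intersectingP => S U /sF SH /sF; move: SH.
rewrite !in_setU1 => /orP[/eqP->|SS] /orP[/eqP->|UU].
- by rewrite setIid -card_gt0 card_setC cards1 subn_gt0.
- by rewrite setIC ne.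
- exact: ne.
- apply/set0Pn; exists a; move: SS UU.
  by rewrite !inE => /andP[_ ->] /andP[_ ->].
Qed.

Lemma star_core_valid n (a : 'I_n) (F : {set {set 'I_n}}) : 3 < n ->
  (star_core a \subset F) && (F \subset hilton_milner a) ->
  [&& F \subset V n, intersecting F & ker F == set0].
Proof.
move=> n3 /andP[/subsetP sCF sFH].
have iF := hilton_milner_intersecting (ltnW (ltnW n3)) sFH; rewrite iF /=.
apply/andP; split.
  apply/subsetP => S SF; rewrite inE.
  by have := intersectingP _ iF _ _ SF SF; rewrite setIid.
apply/eqP/setP => x; rewrite inE; apply/negP => /bigcapP kx.
have : x \in ~: [set a] by apply/kx/sCF/setU11.
rewrite !inE => xa.
have [b] : exists b, b \notin [set a; x].
  by apply: exists_notin; rewrite cards2; case: (_ != _); lia.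
rewrite !inE negb_or => /andP[ba bx].
have : x \in [set a; b].
  by apply/kx/sCF/setU1r/imsetP; exists b; rewrite ?inE.
by rewrite !inE (negPf xa) eq_sym (negPf bx).
Qed.

(** For distinct [a] and [c], a set {c, b} missing [a] could lie in the family of [a] only as [~:
    [set a]], but a fourth point d is missing from it. *)
Lemma star_core_inj n (a c : 'I_n) (F : {set {set 'I_n}}) : 3 < n ->
  (star_core a \subset F) && (F \subset hilton_milner a) ->
  (star_core c \subset F) && (F \subset hilton_milner c) -> a = c.
Proof.
move=> n3 /andP[_ /subsetP sFH] /andP[/subsetP sCF _].
apply/eqP; apply: contraT => ac.
have [b] : exists b, b \notin [set a; c].
  by apply: exists_notin; rewrite cards2; case: (_ != _); lia.
rewrite !inE negb_or => /andP[ba bc].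
have : [set c; b] \in hilton_milner a.
  by apply/sFH/sCF/setU1r/imsetP; exists b; rewrite ?inE.
have [d] : exists d, d \notin [set a; c; b].
  by apply: exists_notin; apply: leq_ltn_trans (card_set3_leq _ _ _) _.
rewrite !inE !negb_or => /andP[/andP[da dc] db].
rewrite (negPf ac) (eq_sym a b) (negPf ba) andbF orbF => /eqP/setP/(_ d).
by rewrite !inE (negPf da) (negPf dc) (negPf db).
Qed.

(** Each of the [n - 1] forced two-element sets contributes its weight [q - 1] instead of [q];
    multiplying by [q ^ (n - 1)] avoids division. *)
Lemma sum_star_core n (a : 'I_n) : 1 < n ->
  let q := 2 ^ (2 ^ (n - 2)) in
  (\sum_(F : {set {set 'I_n}} |
          (star_core a \subset F) && (F \subset hilton_milner a))
     \prod_(S in F) weight S) * q ^ (n - 1)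
  = 3 * (q - 1) ^ (n - 1) * 2 ^ mass (punctured_star a).
Proof.
move=> n1 q.
have nC : ~: [set a] \notin two_sets a.
  by apply: contra (setC1_notin_star a); apply: subsetP; exact: two_sets_sub.
rewrite sum_prod_between; last exact: setUS (two_sets_sub a).
rewrite big_setU1 //= weight_setC1.
rewrite (eq_bigr (fun=> q - 1)); last first.
  by move=> S /card_two_set S2; rewrite /weight S2.
rewrite prod_nat_const card_two_sets -!mulnA; congr (3 * (_ * _)).
have -> : hilton_milner a :\: star_core a = punctured_star a :\: two_sets a.
  apply/setP => S; rewrite /hilton_milner /star_core.
  rewrite [LHS]in_setD [RHS]in_setD !in_setU1.
  case: (eqVneq S (~: [set a])) => [->|_]; last by [].
  by rewrite (negPf (setC1_notin_star a)) andbF.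
rewrite prod_weightS /mass [in RHS](big_setID (two_sets a)) /= expnD mulnC.
congr (_ * _).
rewrite (setIidPr (two_sets_sub a)) (eq_bigr (fun=> 2 ^ (n - 2))).
  by rewrite sum_nat_const card_two_sets mulnC expnM.
by move=> S /card_two_set ->.
Qed.

Lemma Rsum_lower n : 25 <= n ->
  3 * n * 2 ^ Mstar n <= 4 * Rsum n + 3 * 2 ^ Mstar n.
Proof.
move=> n25; have n0 : 0 < n by lia.
have n3 : 3 < n by lia.
have n1 : 1 < n by lia.
pose q := 2 ^ (2 ^ (n - 2)); have q0 : 0 < q by rewrite expn_gt0.
(* This is the hypothesis of [mul_expS_leq] for exponent [n - 1], with [q] in the role of its
   successor. *)
have nq : n * (n - 1) <= q.
  apply: leq_trans (_ : 2 ^ n * 2 ^ n <= _).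
    have le : n <= 2 ^ n by apply: ltnW; exact: ltn_expl.
    by apply: leq_mul => //; exact: leq_trans (leq_subr _ _) le.
  rewrite -expnD leq_exp2l //.
  have -> : n - 2 = (n - 3).+1 by lia.
  by rewrite expnS; have := linear_leq_exp2 n25; lia.
have eR : \sum_(a < n) \sum_(F : {set {set 'I_n}} |
           (star_core a \subset F) && (F \subset hilton_milner a))
      \prod_(S in F) weight S <= Rsum n.
  apply: (@sum_pred_packing _ _ _ (fun (a : 'I_n) (F : {set {set 'I_n}}) =>
    (star_core a \subset F) && (F \subset hilton_milner a))).
    by move=> a F; exact: star_core_valid.
  by move=> a c F; exact: star_core_inj.
rewrite -(leq_pmul2r (_ : 0 < q ^ (n - 1))) ?expn_gt0 ?q0 //.
have := @mul_expS_leq n (n - 1) q.-1.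
rewrite (prednK q0) => /(_ nq) hq.
apply: leq_trans (_ : 4 * (n * (3 * q.-1 ^ (n - 1) *
    2 ^ mass (punctured_star (Ordinal n0)))) + 3 * 2 ^ Mstar n * q ^ (n - 1) <= _).
  rewrite (exp2_Mstar (Ordinal n0)); set Z := 2 ^ _.
  have -> : 3 * n * (4 * Z) * q ^ (n - 1) = 12 * Z * (n * q ^ (n - 1)) by ring.
  have -> : 4 * (n * (3 * q.-1 ^ (n - 1) * Z)) + 3 * (4 * Z) * q ^ (n - 1)
          = 12 * Z * (n * q.-1 ^ (n - 1) + q ^ (n - 1)) by ring.
  by rewrite leq_mul2l hq orbT.
rewrite mulnDl leq_add2r -[4 * Rsum n * _]mulnA leq_mul2l /=.
apply: leq_trans (_ : (\sum_(a < n) \sum_(F : {set {set 'I_n}} |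
           (star_core a \subset F) && (F \subset hilton_milner a))
      \prod_(S in F) weight S) * q ^ (n - 1) <= _); last by rewrite leq_mul2r eR orbT.
rewrite big_distrl /=.
rewrite (eq_bigr (fun=> 3 * q.-1 ^ (n - 1) *
    2 ^ mass (punctured_star (Ordinal n0)))).
  by rewrite sum_nat_const card_ord.
by move=> a _; rewrite sum_star_core // subn1 !mass_punctured_star.
Qed.

(* Passage to the real limit *)
From mathcomp Require Import all_boot all_order all_algebra lra.
From mathcomp Require Import all_classical all_reals all_analysis.
Import Order.TTheory GRing.Theory Num.Theory.
Import numFieldNormedType.Exports.
Local Open Scope classical_set_scope.
Local Open Scope ring_scope.

Theorem theorem5p8 (K : realType) :
  exists eps : nat -> K,
    eps @ \oo --> (0 : K) /\
    forall n : nat, (0 < n)%N ->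
      (Rsum n)%:R = (3 / 4 + eps n) * n%:R * 2 ^+ Mstar n :> K.
Proof.
pose eps n : K := (Rsum n)%:R / (n%:R * 2 ^+ Mstar n) - 3 / 4.
exists eps; split; last first.
  move=> n n0; rewrite /eps.
  have n0' : n%:R != 0 :> K by rewrite pnatr_eq0 -lt0n.
  have M0 : 2 ^+ Mstar n != 0 :> K by rewrite expf_neq0 ?pnatr_eq0.
  by field; rewrite n0' M0.
(* The integer bounds place [eps n] between -3/(4n) and 1/(2n), and 3/(4n) is at most 2/(n+1), which
   is twice [harmonic n]. *)
have bound n : (25 <= n)%N -> - (2 * harmonic n) <= eps n <= 2 * harmonic n.
  move=> n25; have n0 : (0 < n)%N by lia.
  have nR : 0 < n%:R :> K by rewrite ltr0n.
  have n1R : 1 <= n%:R :> K by rewrite ler1n.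
  have MR : 0 < 2 ^+ Mstar n :> K by rewrite exprn_gt0.
  have up : 4 * (Rsum n)%:R <= 3 * n%:R * 2 ^+ Mstar n + 2 * 2 ^+ Mstar n :> K.
    by rewrite -natrX -!natrM -natrD ler_nat; exact: Rsum_upper.
  have lo : 3 * n%:R * 2 ^+ Mstar n <= 4 * (Rsum n)%:R + 3 * 2 ^+ Mstar n :> K.
    by rewrite -natrX -!natrM -natrD ler_nat; exact: Rsum_lower.
  have eE : eps n * (n%:R * 2 ^+ Mstar n) = (Rsum n)%:R - 3 / 4 * (n%:R * 2 ^+ Mstar n).
    by rewrite /eps mulrBl divfK // mulf_neq0 ?gt_eqF.
  have hE : harmonic n * (n%:R + 1) = 1 :> K.
    by rewrite /harmonic /= -natr1 mulVf // gt_eqF // ltr_wpDl.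
  have h0 : 0 <= harmonic n :> K by rewrite ltW ?harmonic_gt0.
  have hn : 3 / 4 <= 2 * harmonic n * n%:R :> K by nra.
  have P0 : 0 < n%:R * 2 ^+ Mstar n :> K by rewrite mulr_gt0.
  have hM : 3 / 4 * 2 ^+ Mstar n <= 2 * harmonic n * (n%:R * 2 ^+ Mstar n) :> K.
    by rewrite mulrA ler_pM2r.
  by apply/andP; split; rewrite -(ler_pM2r P0) eE ?mulNr; lra.
have h2 : (fun n => 2 * harmonic n : K) @ \oo --> (0 : K).
  by rewrite -[0](mulr0 2); apply: cvgMr; exact: cvg_harmonic.
have hN : (fun n => - (2 * harmonic n) : K) @ \oo --> (0 : K).
  by rewrite -[X in _ --> X]oppr0; apply: cvgN; exact: h2.
apply: (squeeze_cvgr _ hN h2).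
by exists 25%N => // n /= n25; exact: bound.
Qed.
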